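(* Let $X$ be a set and let $\mathcal{L}$ and $\mathcal{R}$ be two nests on $X$ such that $\mathcal{L}\cup\mathcal{R}$ is $T_1$-separating, and equip $X$ with the topology having $\mathcal{L}\cup\mathcal{R}$ as a subbase (so that $\mathcal{L}$ and $\mathcal{R}$ consist of open sets). If $X$ is connected with respect to this topology, then $\mathcal{L}$ and $\mathcal{R}$ are interlocking nests.
   Context: A nest on $X$ is a family of subsets of $X$ that is linearly ordered by inclusion. A collection $\mathcal{S}$ of subsets of $X$ is $T_1$-separating (it $T_1$-separates $X$) if for all $x\neq y$ in $X$ there exist $S,T\in\mathcal{S}$ such that $x\in S$, $y\notin S$, $y\in T$ and $x\notin T$. A collection $\mathcal{S}\subset\mathcal{P}(X)$ is interlocking if for each $T\in\mathcal{S}$ such that $T=\bigcap\{S : T\subset S,\ S\in\mathcal{S}-\{T\}\}$ we have $T=\bigcup\{S : S\subset T,\ S\in\mathcal{S}-\{T\}\}$.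
   Formalization: In the definition of interlocking, the intersection condition on T is imposed only when some member other than T contains T; with the empty intersection read as X the claim fails for X a single point, L = {X}, R empty. *)

(* Defs.v *)
From HB Require Import structures.
From mathcomp Require Import all_boot.
From mathcomp Require Import all_classical topology.

Set Implicit Arguments.
Unset Strict Implicit.
Unset Printing Implicit Defensive.

Local Open Scope classical_set_scope.

Definition nest (X : Type) (N : set (set X)) : Prop := total_on N subset.

Definition T1_separating (X : Type) (A : set (set X)) : Prop :=
  forall x y : X, x <> y ->
    exists S T : set X, [/\ A S, A T, S x /\ ~ S y & T y /\ ~ T x].

(* The intersection of a family is taken only over a nonempty family, hence
   the guard [!=set0]. It matters only for T = setT: otherwise an empty family
   has \bigcap = setT <> T, so T would be unconstrained anyway. Without the
   guard a member setT would have to be the union of the other members, and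
   already the one-point space with L = [set setT], R = set0 would be a
   connected space whose nest L is not interlocking. *)
Definition interlocking (X : Type) (A : set (set X)) : Prop :=
  forall T : set X, A T ->
    [set S | (A `\ T) S /\ T `<=` S] !=set0 ->
    T = \bigcap_(S in [set S | (A `\ T) S /\ T `<=` S]) S ->
    T = \bigcup_(S in [set S | (A `\ T) S /\ S `<=` T]) S.

(* An alias of X carrying the topology with subbase B. The empty intersection
   is setT, so B need not cover X. *)
Definition subbase_topology (X : Type) (B : set (set X)) : Type := X.

HB.instance Definition _ (X : Type) (B : set (set X)) :=
  gen_eqMixin (subbase_topology B).
HB.instance Definition _ (X : Type) (B : set (set X)) :=
  gen_choiceMixin (subbase_topology B).
HB.instance Definition _ (X : Type) (B : set (set X)) :=
  isSubBaseTopological.Build (subbase_topology B) (B : set (set X)) id.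

(* Main.v *)
Require Import Defs.
From mathcomp Require Import all_boot.
From mathcomp Require Import all_classical topology.

Local Open Scope classical_set_scope.

(** Interlocking can only fail at a nonempty member [T] of, say, [L] that is the
    intersection of the members of [L] strictly above it. Such a [T] is open,
    being in the subbase, and the point is that it is also closed. A point [y]
    outside [T] is missed by some [S] in [L] strictly larger than [T]; pick [w]
    in [S] but not in [T]. Along [L] the order is then [T], [w], [y], and since
    the members of [L] are nested, none of them separates a later item from an
    earlier one. Separation in that direction must come from [R]: some [Q] in
    [R] contains [y] but not [w], and each [z] in [T] is missed by some [Qz] in
    [R] containing [w]. As [R] is a nest, [Q] lies inside every [Qz], so [Q] is
    an open neighbourhood of [y] disjoint from [T] ([limit_member_closed]).

    By connectedness a nonempty clopen [T] is the whole space, and then no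
    member can lie strictly above it. So in the situation that interlocking
    speaks about, [T] is empty, and it is trivially the union of the members
    below it. *)

Lemma subbase_open (X : Type) (B : set (set X)) (T : set X) :
  B T -> open (T : set (subbase_topology B)).
Proof.
move=> BT.
exists [set T]; last by rewrite bigcup_set1.
by move=> _ ->; apply: (@finI_from1 _ _ B id).
Qed.

Lemma nest_mem_sub {X : Type} {N : set (set X)} {S T : set X} {x : X} :
  nest N -> N S -> N T -> S x -> ~ T x -> T `<=` S.
Proof. by move=> nestN NS NT Sx nTx; case: (nestN _ _ NS NT) => // /(_ _ Sx). Qed.

(** Nestedness of [N] forbids its members from separating [b] from [a] when some
    member already separates [a] from [b], so the other family has to do it. *)
Lemma separated_by_other_nest {X : Type} {N M : set (set X)} {S : set X}
    {a b : X} :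
  nest N -> T1_separating (N `|` M) -> N S -> S a -> ~ S b ->
  exists2 Q, M Q & Q b /\ ~ Q a.
Proof.
move=> nestN sep NS Sa nSb.
have neq_ba : b <> a by move=> eq_ba; apply: nSb; rewrite eq_ba.
have [Q [_ [[NQ|MQ] _ [Qb nQa] _]]] := sep _ _ neq_ba; last by exists Q.
by case: nQa; apply: (nest_mem_sub nestN NQ NS Qb nSb).
Qed.

(** The point [w] strictly between [T] and [y] is what makes one member of [M]
    avoid all of [T] at once: a single member of [M] cuts [y] off from [w], and
    it is below all those that cut [w] off from the points of [T]. *)
Lemma limit_member_closed (X : Type) (N M : set (set X)) (T : set X) :
  nest N -> nest M -> T1_separating (N `|` M) -> N T ->
  T = \bigcap_(S in [set S | (N `\ T) S /\ T `<=` S]) S ->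
  closed (T : set (subbase_topology (N `|` M))).
Proof.
move=> nestN nestM sep NT capT.
rewrite -openC openE => y /= nTy.
have [S [[NS neqST] subTS] nSy] :
    exists2 S, (N `\ T) S /\ T `<=` S & ~ S y.
  apply: contrapT => noS; apply: nTy; rewrite capT => S NTS.
  by apply: contrapT => nSy; apply: noS; exists S.
have [w Sw nTw] : exists2 w, S w & ~ T w.
  apply: contrapT => now; apply: neqST; apply/seteqP; split=> // w Sw.
  by apply: contrapT => nTw; apply: now; exists w.
have [Q MQ [Qy nQw]] := separated_by_other_nest nestN sep NS Sw nSy.
have disjQT : Q `<=` ~` T.
  move=> z Qz Tz.
  have [Qz' MQz' [Qz'w nQz'z]] := separated_by_other_nest nestN sep NT Tz nTw.
  by apply: nQz'z; apply: (nest_mem_sub nestM MQz' MQ Qz'w nQw).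
apply: (@filterS _ (nbhs (y : subbase_topology (N `|` M))) _ Q) => //.
by apply: open_nbhs_nbhs; split=> //; apply: subbase_open; right.
Qed.

Lemma connected_interlocking (X : Type) (N M : set (set X)) :
  nest N -> nest M -> T1_separating (N `|` M) ->
  connected [set: subbase_topology (N `|` M)] -> interlocking N.
Proof.
move=> nestN nestM sep conn T NT [S0 [[_ neqS0T] subTS0]] capT.
have [->|/set0P T0] := eqVneq T set0.
  by apply/seteqP; split=> // x [S [_ subS0] /subS0].
have TT : (T : set (subbase_topology (N `|` M))) = setT.
  apply: conn => //; exists T; rewrite ?setTI//.
    by apply: subbase_open; left.
  exact: limit_member_closed.
by case: neqS0T; apply/seteqP; split=> // x _; rewrite TT.
Qed.

Theorem theorem7 (X : Type) (L R : set (set X)) (nestL : nest L)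
    (nestR : nest R) (sepLR : T1_separating (L `|` R))
    (connX : connected [set: subbase_topology (L `|` R)]) :
  interlocking L /\ interlocking R.
Proof.
split; first exact: (connected_interlocking X L R).
by rewrite setUC in sepLR connX; apply: (connected_interlocking X R L).
Qed.
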